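(* For all positive integers $d,k$ the following hold: (i) $\Lambda_d(k)$ determines exactly $k$ distinct $\ell^1$-distances, namely $2,4,\dots,2k$; (ii) $|\Lambda_1(k)|=k+1$ and $|\Lambda_d(1)|=2d$; (iii) $\displaystyle |\Lambda_{d+1}(k)|=|\Lambda_d(k)|+2\sum_{j=0}^{k-1}|\Lambda_d(j)|$.
   Context: For $x=(x_1,\dots,x_d)\in\mathbb{R}^d$, $\|x\|_1=|x_1|+\cdots+|x_d|$, and the $\ell^1$-distance between $x,y$ is $\|x-y\|_1$. A set $P\subseteq\mathbb{R}^d$ determines the $\ell^1$-distance $\lambda$ if $\lambda=\|x-y\|_1$ for some $x,y\in P$ with $x\neq y$ (so $0$ is never counted as a determined distance). For integers $d>0$, $k\ge 0$, $\Lambda_d(k)=\{n=(n_1,\dots,n_d)\in\mathbb{Z}^d:\ \|n\|_1\le k,\ n_1+\cdots+n_d\equiv k \pmod 2\}$. *)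

(* Defs.v *)
From HB Require Import structures.
From mathcomp Require Import all_boot all_order all_algebra.
From mathcomp Require Import finmap.
From mathcomp Require Import boolp classical_sets functions cardinality reals.

Set Implicit Arguments.
Unset Strict Implicit.
Unset Printing Implicit Defensive.

Import Order.TTheory GRing.Theory Num.Theory.

Local Open Scope classical_set_scope.
Local Open Scope ring_scope.

Definition l1norm (K : numDomainType) (d : nat) (x : 'rV[K]_d) : K :=
  \sum_(i < d) `|x 0 i|.

Definition l1_determines (K : numDomainType) (d : nat)
    (P : set 'rV[K]_d) (lambda : K) : Prop :=
  exists x y : 'rV[K]_d, [/\ P x, P y, x <> y & lambda = l1norm (x - y)].

Definition Lambda (d k : nat) : set 'rV[int]_d :=
  [set n : 'rV[int]_d | l1norm n <= k%:Z
                        /\ (\sum_(i < d) n 0 i = k%:Z %[mod 2])%Z].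
Arguments Lambda d k : clear implicits.

(* The image of a subset of Z^d under the inclusion of Z^d into R^d. *)
Definition in_Rd (R : realType) (d : nat) (A : set 'rV[int]_d) : set 'rV[R]_d :=
  [set map_mx (fun m : int => m%:~R) n | n in A].
Arguments in_Rd R {d} A.

(* [fset_set] sends every infinite set to the empty one, so [cardinal A] is
   the number of elements of A only for finite A; see [Lambda_finite]. *)
Definition cardinal (T : choiceType) (A : set T) : nat := #|` fset_set A |%fset.

Lemma Lambda_finite (d k : nat) : finite_set (Lambda d k).
Proof.
pose f (g : {ffun 'I_d -> 'I_(k.*2.+1)}) : 'rV[int]_d :=
  \row_i ((g i : nat)%:Z - k%:Z).
apply: (@sub_finite_set _ _ (f @` setT)); last first.
  exact/finite_image/finite_finset.
move=> n [hn _].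
have hi i : `|n 0 i| <= k%:Z.
  apply: le_trans hn; rewrite /l1norm (bigD1 i) //= lerDl.
  by apply: sumr_ge0 => j _; exact: normr_ge0.
exists [ffun i => inord `|(n 0 i + k%:Z)%R|%N] => //.
apply/rowP => i; rewrite !mxE ffunE.
have := hi i; rewrite ler_norml => /andP[h1 h2].
have h0 : 0 <= n 0 i + k%:Z by rewrite -lerBlDr sub0r.
rewrite inordK; first by rewrite gez0_abs // addrK.
by rewrite ltnS -lez_nat gez0_abs // -addnn PoszD lerD2r.
Qed.

(* Main.v *)
Require Import Defs.
From HB Require Import structures.
From mathcomp Require Import all_boot all_order all_algebra.
From mathcomp Require Import finmap.
From mathcomp Require Import boolp classical_sets functions cardinality reals.
From mathcomp Require Import zify.

Set Implicit Arguments.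
Unset Strict Implicit.
Unset Printing Implicit Defensive.

Import Order.TTheory GRing.Theory Num.Theory.

Local Open Scope classical_set_scope.
Local Open Scope ring_scope.

(* Sorting the points of Lambda_{d+1}(k) by their first coordinate m, the slice
   at m is a copy of Lambda_d(k - |m|); summing over |m| <= k gives (iii).
   Since this also holds for d = 0, where Lambda_0(k) has one point if k is even
   and none otherwise, the counts in (ii) follow from it.  For (i), the
   distance of two points is at most 2k by the triangle inequality and is even
   because |m| = m mod 2; conversely 2j is the distance between k e_0 and
   (k - 2j) e_0. *)

(** The list [s] witnesses that [A] is finite, so [fset_set A] is not the default empty set. The
    recurrence, its base case and the number of distances are all counted by such an explicit
    list. *)
Lemma cardinal_seq (T : choiceType) (A : set T) (s : seq T) :
  uniq s -> (forall x, A x <-> x \in s) -> cardinal A = size s.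
Proof.
move=> us As; have fs : finite_set [set` s] by exact: finite_seq.
have -> : A = [set` s] by apply/seteqP; split=> x /As.
rewrite /cardinal -[in RHS](undup_id us) -(size_seq_fset tt).
congr (size (enum_fset _)); apply/fsetP=> x.
by rewrite in_fset_set // seq_fsetE mem_setE.
Qed.

Definition consrow (d : nat) (m : int) (v : 'rV[int]_d) : 'rV[int]_d.+1 :=
  \row_i oapp (v 0) m (unlift ord0 i).

Lemma consrow0 d m (v : 'rV_d) : consrow m v 0 ord0 = m.
Proof. by rewrite mxE unlift_none. Qed.

Lemma consrowS d m (v : 'rV_d) i : consrow m v 0 (lift ord0 i) = v 0 i.
Proof. by rewrite mxE liftK. Qed.

Lemma consrow_eta d (v : 'rV_d.+1) :
  consrow (v 0 ord0) (\row_i v 0 (lift ord0 i)) = v.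
Proof.
by apply/rowP=> i; case: (unliftP ord0 i) => [j|] ->;
  rewrite ?consrow0 // consrowS mxE.
Qed.

Lemma consrow_inj d (m m' : int) (v v' : 'rV_d) :
  consrow m v = consrow m' v' -> m = m' /\ v = v'.
Proof.
move=> e; split; first by rewrite -(consrow0 m v) e consrow0.
by apply/rowP=> i; rewrite -(consrowS m v) e consrowS.
Qed.

(** Dropping the first coordinate lowers the norm by [|m|] and the sum by [m], which is congruent to
    [|m|] mod 2. The bound [|m| <= k] keeps the subtraction in [nat] from truncating. *)
Lemma Lambda_consrow d k m (v : 'rV_d) :
  Lambda d.+1 k (consrow m v) <->
  (`|m| <= k)%N /\ Lambda d (k - `|m|)%N v.
Proof.
rewrite /Lambda /= /l1norm !big_ord_recl !consrow0.
rewrite (eq_bigr (fun i => `|v 0 i|)) => [|i _]; last by rewrite consrowS.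
rewrite [X in m + X](eq_bigr (fun i => v 0 i)) => [|i _]; last first.
  by rewrite consrowS.
(* Nonnegativity of the remaining norm is what forces [|m| <= k]. *)
have : 0 <= \sum_(i < d) `|v 0 i| by apply: sumr_ge0.
move: (\sum_(i < d) `|v 0 i|) (\sum_(i < d) v 0 i) => a b a0.
by split; lia.
Qed.

(** The integers from [-k] to [k], ordered as zero, positives, negatives to match the three terms of
    the recurrence. *)
Definition centered_range (k : nat) : seq int :=
  0 :: [seq (k - j)%:Z | j <- iota 0 k] ++ [seq - (k - j)%:Z | j <- iota 0 k].

Lemma mem_centered_range k (m : int) : (m \in centered_range k) = (`|m| <= k)%N.
Proof.
rewrite inE mem_cat; apply/idP/idP.
  by case/or3P => [/eqP->|/mapP[j]|/mapP[j]]; rewrite ?mem_iota; lia.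
move=> mk; case: (ltgtP m 0) => [m0|m0|-> //]; rewrite ?orbT //=.
  by apply/orP; right; apply/mapP; exists (k - `|m|)%N; rewrite ?mem_iota; lia.
by apply/orP; left; apply/mapP; exists (k - `|m|)%N; rewrite ?mem_iota; lia.
Qed.

Lemma centered_range_uniq k : uniq (centered_range k).
Proof.
rewrite cons_uniq mem_cat cat_uniq; apply/and4P; split.
- by apply/negP=> /orP[] /mapP[j]; rewrite mem_iota; lia.
- by rewrite map_inj_in_uniq ?iota_uniq // => i j; rewrite !mem_iota; lia.
- apply/hasPn=> _ /mapP[j + ->]; rewrite mem_iota => jk.
  by apply/negP=> /mapP[i]; rewrite mem_iota; lia.
- by rewrite map_inj_in_uniq ?iota_uniq // => i j; rewrite !mem_iota; lia.
Qed.

Lemma cardinal_LambdaS d k :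
  cardinal (Lambda d.+1 k)
  = (cardinal (Lambda d k) + 2 * \sum_(0 <= j < k) cardinal (Lambda d j))%N.
Proof.
pose slice (m : int) : seq 'rV[int]_d := fset_set (Lambda d (k - `|m|)%N).
have sliceE m v : (v \in slice m) = (v \in Lambda d (k - `|m|)%N).
  by rewrite -in_fset_set //; exact: Lambda_finite.
rewrite (@cardinal_seq _ _
  [seq consrow m v | m <- centered_range k, v <- slice m]); first last.
- move=> x; split=> [|/allpairsPdep[m [v [+ + ->]]]].
    rewrite -(consrow_eta x) => /Lambda_consrow[mk Lv].
    by apply: allpairs_f_dep; rewrite ?mem_centered_range // sliceE inE.
  by rewrite mem_centered_range sliceE inE => mk Lv; apply/Lambda_consrow.
- apply: allpairs_uniq_dep; first exact: centered_range_uniq.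
    by move=> m _; exact: fset_uniq.
  by move=> [m v] [m' v'] _ _ /= /consrow_inj[-> ->].
rewrite size_allpairs_dep /= map_cat sumn_cat -!map_comp mul2n -addnn.
have -> : size (slice 0) = cardinal (Lambda d k) by rewrite /slice subn0.
(* The slices at [k - j] and [-(k - j)] are both [Lambda d j], so each half of the range contributes
   the same sum over [j < k]. *)
by congr (_ + (_ + _))%N; rewrite sumnE big_map /index_iota subn0;
  apply: eq_big_seq => j; rewrite mem_iota /= => jk;
  congr (size (enum_fset (fset_set (Lambda d _)))); lia.
Qed.

Lemma cardinal_Lambda0 k : cardinal (Lambda 0 k) = ~~ odd k.
Proof.
rewrite (@cardinal_seq _ _ (nseq (~~ odd k) 0)) ?size_nseq //.
  by case: (odd k).
move=> x; rewrite [x]thinmx0 mem_nseq eqxx andbT /Lambda /= /l1norm !big_ord0.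
by split=> [[]|]; lia.
Qed.

Lemma cardinal_Lambda1 k : cardinal (Lambda 1 k) = k.+1.
Proof.
rewrite cardinal_LambdaS; under eq_bigr do rewrite cardinal_Lambda0.
(* What remains is arithmetic: the indicator of [k] even plus twice the number of even [j < k]
   equals [k + 1]. *)
rewrite cardinal_Lambda0; elim: k => [|k IH]; first by rewrite big_nil.
by rewrite big_nat_recr //=; lia.
Qed.

Lemma cardinal_Lambda_0 d : cardinal (Lambda d 0) = 1%N.
Proof.
elim: d => [|d IH]; first by rewrite cardinal_Lambda0.
by rewrite cardinal_LambdaS big_nil IH.
Qed.

(** The count starts at 0 in dimension 0, and each new dimension adds twice the single point of
    [Lambda d 0]. *)
Lemma cardinal_Lambda_1 d : cardinal (Lambda d 1) = (2 * d)%N.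
Proof.
elim: d => [|d IH]; first by rewrite cardinal_Lambda0.
by rewrite cardinal_LambdaS big_nat1 cardinal_Lambda_0 IH; lia.
Qed.

Lemma l1norm_ge0 (K : numDomainType) d (x : 'rV[K]_d) : 0 <= l1norm x.
Proof. exact: sumr_ge0. Qed.

Lemma l1norm_eq0 (K : numDomainType) d (x : 'rV[K]_d) : l1norm x = 0 -> x = 0.
Proof.
move=> /eqP; rewrite psumr_eq0 // => /allP x0; apply/rowP=> i.
by rewrite mxE; apply/eqP; rewrite -normr_eq0; exact/x0/mem_index_enum.
Qed.

Lemma l1normB (K : numDomainType) d (x y : 'rV[K]_d) :
  l1norm (x - y) <= l1norm x + l1norm y.
Proof.
by rewrite -big_split; apply: ler_sum => i _; rewrite !mxE; exact: ler_normB.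
Qed.

Lemma l1norm_mod2 d (x : 'rV[int]_d) :
  (l1norm x = \sum_(i < d) x 0 i %[mod 2])%Z.
Proof.
apply: (big_ind2 (fun a b => (a = b %[mod 2])%Z)) => [//|a b a' b'|i _] /=.
  by lia.
by move: (x 0 i) => a; lia.
Qed.

Lemma l1normB_intr (R : realType) d (x y : 'rV[int]_d) :
  l1norm (map_mx (fun m : int => m%:~R : R) x - map_mx (fun m => m%:~R) y)
  = (l1norm (x - y))%:~R.
Proof.
rewrite /l1norm /= rmorph_sum; apply: eq_bigr => i _.
by rewrite !mxE /= intr_norm rmorphB.
Qed.

(** The inclusion of the integer points is injective and commutes with distances, which reduces (i)
    to integers. *)
Lemma l1_determines_in_Rd (R : realType) d (A : set 'rV[int]_d) (lambda : R) :
  l1_determines (in_Rd R A) lambda <->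
  exists2 n : int, l1_determines A n & lambda = n%:~R.
Proof.
split=> [[_ [_ [[x Ax <-] [y Ay <-] xy ->]]]|[_ [x [y [Ax Ay xy ->]]] ->]].
  exists (l1norm (x - y)); last exact: l1normB_intr.
  by exists x, y; split=> // e; apply: xy; rewrite e.
exists (map_mx intr x), (map_mx intr y); split; [by exists x | by exists y | |].
  move=> /rowP e; apply: xy; apply/rowP=> i.
  by have := e i; rewrite !mxE => /intr_inj.
by rewrite l1normB_intr.
Qed.

Lemma l1_determines_Lambda d k (n : int) : (0 < d)%N ->
  l1_determines (Lambda d k) n <->
  exists2 j : nat, (1 <= j <= k)%N & n = (2 * j)%:Z.
Proof.
case: d => // d _; split=> [[x [y [[xk xm] [yk ym] xy ->]]]|[j jk ->]].
  have le2k := l1normB x y; have ge0 := l1norm_ge0 (x - y).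
  have neq0 : l1norm (x - y) <> 0 by move=> /l1norm_eq0 /subr0_eq.
  have := l1norm_mod2 (x - y).
  have sumB : \sum_i (x - y) 0 i = \sum_i x 0 i - \sum_i y 0 i.
    by rewrite -sumrB; apply: eq_bigr => i _; rewrite !mxE.
  rewrite {}sumB; move: (l1norm (x - y)) (l1norm x) (l1norm y) (\sum_i x 0 i)
    (\sum_i y 0 i) xk yk xm ym le2k ge0 neq0 => l a b sx sy *.
  (* Both coordinate sums are congruent to [k], so [l] is even; it is also nonzero and at most
     [2k]. *)
  by exists (`|l| %/ 2)%N; lia.
have Lambda_axis (m : int) :
    `|m| <= k%:Z -> (m = k%:Z %[mod 2])%Z -> Lambda d.+1 k (consrow m 0).
  move=> mk mm; apply/Lambda_consrow; split; first by lia.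
  by rewrite /Lambda /= /l1norm !big1 => [|i _|i _]; rewrite ?mxE //; lia.
(* For [1 <= j <= k] the value [k - 2j] lies between [-k] and [k], differs from [k] and has its
   parity. *)
exists (consrow k%:Z 0), (consrow (k%:Z - (2 * j)%:Z) 0); split.
- by apply: Lambda_axis; lia.
- by apply: Lambda_axis; lia.
- by move=> /consrow_inj[]; lia.
rewrite /l1norm big_ord_recl !mxE unlift_none big1 => [|i _] /=; first by lia.
by rewrite !mxE liftK /= !mxE subrr.
Qed.

Theorem theorem2p2 (R : realType) (d k : nat) (hd : (0 < d)%N) (hk : (0 < k)%N) :
  (cardinal [set lambda : R | l1_determines (in_Rd R (Lambda d k)) lambda] = k
   /\ [set lambda : R | l1_determines (in_Rd R (Lambda d k)) lambda]
      = [set (2 * j)%:R | j in [set j : nat | (1 <= j <= k)%N]])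
  /\ (cardinal (Lambda 1 k) = k.+1 /\ cardinal (Lambda d 1) = (2 * d)%N)
  /\ cardinal (Lambda d.+1 k)
     = (cardinal (Lambda d k) + 2 * \sum_(0 <= j < k) cardinal (Lambda d j))%N.
Proof.
have distE : [set lambda : R | l1_determines (in_Rd R (Lambda d k)) lambda]
    = [set (2 * j)%:R | j in [set j : nat | (1 <= j <= k)%N]].
  apply/seteqP; split=> [l /l1_determines_in_Rd[n]|_ [j jk <-]].
    by move=> /(l1_determines_Lambda _ _ hd)[j jk ->] ->; exists j.
  apply/l1_determines_in_Rd; exists (2 * j)%:Z => //.
  by apply/l1_determines_Lambda => //; exists j.
split; last first.
  by rewrite cardinal_Lambda1 cardinal_Lambda_1 cardinal_LambdaS.
split=> //; rewrite distE.
rewrite (@cardinal_seq _ _ [seq (2 * j)%:R | j <- iota 1 k]).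
- by rewrite size_map size_iota.
- by rewrite map_inj_uniq ?iota_uniq // => i j /eqP; rewrite eqr_nat; lia.
move=> x; split=> [[j jk <-]|/mapP[j + ->]].
  by apply: map_f; rewrite mem_iota; move: jk => /=; lia.
by rewrite mem_iota => jk; exists j => //=; lia.
Qed.
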